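(* Let $\beta \ge 8$ be real. There is a constant $C=C(\beta)>0$, depending only on $\beta$, such that the following holds. Let $z, D$ be reals with $2\le z\le D^{1/(\beta+1)}$, let $\mathcal{P}$ be a set of primes, and let $P=P(z)=\prod_{p\in\mathcal{P},\,p<z}p$. Let $(\lambda_d)_{d\mid P}$ denote either the upper-bound or the lower-bound beta-sieve weights of level $D$ with parameter $\beta$. Then $$\sum_{d\mid P}d\,\Biggl(\sum_{\substack{m\mid P\\ m\equiv 0\ (\mathrm{mod}\ d)}}\frac{\lambda_m}{m}\Biggr)^2\le C\prod_{p\mid P}\Bigl(1-\frac1p\Bigr).$$
   Context: Sums over $d\mid P$, $m\mid P$ run over positive divisors of the squarefree integer $P$, and $\prod_{p\mid P}$ runs over the primes dividing $P$ (an empty product equals 1). Beta-sieve weights of level $D$ with parameter $\beta$: for a divisor $d$ of $P$ write $d=p_1p_2\cdots p_r$ with primes $p_1>p_2>\cdots>p_r$ ($r=0$ if $d=1$). Let $\mu$ be the Möbius function. - The upper-bound weights are $\lambda_d=\mu(d)$ if $p_1p_2\cdots p_m\,p_m^{\beta}<D$ for every odd $m$ with $1\le m\le r$, and $\lambda_d=0$ otherwise. - The lower-bound weights are $\lambda_d=\mu(d)$ if $p_1p_2\cdots p_m\,p_m^{\beta}<D$ for every even $m$ with $1\le m\le r$, and $\lambda_d=0$ otherwise. In particular $\lambda_1=1$ and $|\lambda_d|\le 1$. *)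

(* Defs.v *)
From mathcomp Require Import all_boot all_order all_algebra.
From mathcomp Require Import boolp classical_sets reals exp.

Set Implicit Arguments.
Unset Strict Implicit.
Unset Printing Implicit Defensive.

Import Order.TTheory GRing.Theory Num.Theory.
Local Open Scope ring_scope.

Definition squarefree (n : nat) : bool :=
  (0 < n)%N && all (fun p => logn p n == 1%N) (primes n).

Definition mobius (n : nat) : int :=
  if squarefree n then (-1) ^+ size (primes n) else 0.

(* The range [0, truncn z] contains every natural number p < z when z >= 0; the
   strict inequality is imposed by the filter. *)
Definition prime_product (R : realType) (A : set nat) (z : R) : nat :=
  (\prod_(0 <= p < (Num.truncn z).+1 | (p \in A) && (p%:R < z)%R) p)%N.

(* [primes d] is increasing, so its reversal lists p_1 > p_2 > ... > p_r. *)
Definition desc_primes (d : nat) : seq nat := rev (primes d).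

(* p_1 p_2 ... p_m p_m^beta < D, for 1 <= m <= r; since [nth] counts from 0,
   p_m is the entry of index m.-1. *)
Definition beta_cond (R : realType) (beta D : R) (d m : nat) : bool :=
  let ps := desc_primes d in
  (\prod_(p <- take m ps) p)%N%:R * (nth 0%N ps m.-1)%:R `^ beta < D.

Definition upper_beta_weight (R : realType) (beta D : R) (d : nat) : R :=
  if all (fun m => odd m ==> beta_cond beta D d m)
         (iota 1 (size (desc_primes d)))
  then (mobius d)%:~R else 0.

Definition lower_beta_weight (R : realType) (beta D : R) (d : nat) : R :=
  if all (fun m => ~~ odd m ==> beta_cond beta D d m)
         (iota 1 (size (desc_primes d)))
  then (mobius d)%:~R else 0.

(* Main.v *)
Require Import Defs.
From mathcomp Require Import all_boot all_order all_algebra.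
From mathcomp Require Import boolp classical_sets reals exp.
From mathcomp Require Import sequences ring lra zify.

Import Order.TTheory GRing.Theory Num.Theory.
Local Open Scope ring_scope.

(**
Write w(d) for the inner sum, lambda for the weights and eps = lambda - mu. For
lambda = mu the quadratic form is exactly prod (1 - 1/p + 1/p^2), so it remains
to bound the form Q at eps. Peel off the largest prime q of P: each divisor
splits into d or q d, and 2xy <= 2x^2 + y^2/2 gives
  Q(l) <= (1 + 2/q) Q(l on divisors of P/q)
          + (3/(2q) + 1/q^2) Q(m |-> l(q m) on divisors of P/q).
For l = eps the second form is that of -eps with one more prime chosen, or that
of mu if the truncation condition fails at q. Failure at the (k+1)-st chosen
prime forces q >= z^((7/8)^k) (this uses beta >= 8), so unrolling the recursion
bounds Q(eps) by the sum over k of 4^-(k+1) times the product of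
1 + 8/p + 4/p^2 over p >= z^((7/8)^k) and of 1 - 1/p + 1/p^2 over smaller p,
the powers of 4 being borrowed from the second form. By Mertens' theorem the
sum of 1/p over z^((7/8)^k) <= p < z is at most k/7 + O(1), so the k-th product
is O(e^(9k/7)) prod (1 - 1/p), and e^(9/7) < 4 makes the series converge.
*)

(** * Divisors of a squarefree number and the quadratic form *)

(** Decreasing order puts the largest prime at the head, so peeling the list follows the order in
    which the weights test their primes. *)
Definition desc_prime_seq (qs : seq nat) : bool :=
  sorted gtn qs && all prime qs.

Lemma desc_prime_seq_cons q qs : desc_prime_seq (q :: qs) ->
  [/\ prime q, all (gtn q) qs & desc_prime_seq qs].
Proof.
rewrite /desc_prime_seq /= => /andP[pqs /andP[pq aqs]].
have gtn_trans : transitive gtn by move=> x y z /= yx xz; exact: ltn_trans xz yx.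
by rewrite pq aqs (order_path_min gtn_trans pqs) (path_sorted pqs).
Qed.

(** Divisors without the head prime come first, then their multiples by it, so that a sum over
    divisors splits as the recursion on the largest prime needs. *)
Fixpoint subset_prods (qs : seq nat) : seq nat :=
  if qs is q :: qs' then subset_prods qs' ++ map (muln q) (subset_prods qs')
  else [:: 1%N].

Lemma subset_prods_primes qs m : desc_prime_seq qs -> m \in subset_prods qs ->
  (0 < m)%N /\ {subset primes m <= qs}.
Proof.
elim: qs m => [|q qs IH] m; first by move=> _; rewrite inE => /eqP->.
move=> /desc_prime_seq_cons[pq _ dqs]; rewrite /= mem_cat => /orP[/IH[]//|].
  by move=> m0 sm; split=> // p /sm; rewrite inE orbC => ->.
move=> /mapP[n /IH[]// n0 sn ->]; split; first by rewrite muln_gt0 prime_gt0.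
move=> p; rewrite primesM ?(prime_gt0 pq)// primes_prime// mem_seq1 inE.
by case/orP=> [->//|/sn->]; rewrite orbT.
Qed.

Lemma subset_prods_ndvd q qs m : desc_prime_seq (q :: qs) ->
  m \in subset_prods qs -> ~~ (q %| m)%N.
Proof.
move=> /desc_prime_seq_cons[pq /allP gtqs dqs] /subset_prods_primes[]// m0 sm.
apply/negP => qm; have /sm/gtqs/= : q \in primes m by rewrite mem_primes pq m0.
by rewrite ltnn.
Qed.

Lemma perm_divisors_prod qs : desc_prime_seq qs ->
  perm_eq (divisors (\prod_(q <- qs) q)) (subset_prods qs).
Proof.
move=> dqs; have P0 : (0 < \prod_(q <- qs) q)%N.
  rewrite big_seq; apply: prodn_cond_gt0 => q qqs.
  by rewrite prime_gt0//; case/andP: dqs => _ /allP; apply.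
apply: uniq_perm; first exact: divisors_uniq.
  elim: qs dqs {P0} => //= q qs IH dqs0.
  have [pq _ dqs] := desc_prime_seq_cons _ _ dqs0.
  rewrite cat_uniq IH// map_inj_uniq ?IH// ?andbT.
    apply/hasPn => _ /mapP[m ms ->]; apply/negP.
    by move=> /(subset_prods_ndvd _ _ _ dqs0); rewrite dvdn_mulr.
  by move=> x y /eqP; rewrite eqn_pmul2l ?prime_gt0// => /eqP.
move=> d; rewrite -dvdn_divisors//.
elim: qs dqs d {P0} => [_ d|q qs IH dqs0 d]; first by rewrite big_nil dvdn1 inE.
have [pq _ dqs] := desc_prime_seq_cons _ _ dqs0.
rewrite big_cons /= mem_cat; apply/idP/orP => [dP|[]].
- case: (boolP (q %| d)%N) dP => [/dvdnP[e ->]|qd].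
    rewrite [(e * q)%N]mulnC dvdn_pmul2l ?(prime_gt0 pq)// IH// => eq.
    by right; apply: map_f.
  rewrite Gauss_dvdr; first by rewrite IH//; left.
  by rewrite coprime_sym prime_coprime.
- by rewrite -IH// => dP; rewrite dvdn_mull.
- by move=> /mapP[e]; rewrite -IH// => eP ->; rewrite dvdn_pmul2l ?prime_gt0.
Qed.

Section QuadraticForm.
Variable R : realFieldType.
Implicit Types (lam mu : nat -> R) (qs : seq nat).

Definition divsum lam qs d : R :=
  \sum_(m <- subset_prods qs | (d %| m)%N) lam m / m%:R.

Definition qform lam qs : R :=
  \sum_(d <- subset_prods qs) d%:R * divsum lam qs d ^+ 2.

Lemma divsum_cons lam q qs d : desc_prime_seq (q :: qs) ->
  d \in subset_prods qs ->
  divsum lam (q :: qs) d =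
    divsum lam qs d + q%:R^-1 * divsum (fun m => lam (q * m)%N) qs d.
Proof.
move=> dqs ds; rewrite /divsum /= big_cat big_map mulr_sumr; congr (_ + _).
apply: eq_big => [m|m _]; last by rewrite natrM invfM mulrCA.
by rewrite Gauss_dvdr// coprime_sym prime_coprime
  ?(subset_prods_ndvd _ _ _ dqs)//; case/desc_prime_seq_cons: dqs.
Qed.

Lemma divsum_consM lam q qs d : desc_prime_seq (q :: qs) ->
  divsum lam (q :: qs) (q * d)%N =
    q%:R^-1 * divsum (fun m => lam (q * m)%N) qs d.
Proof.
move=> dqs; rewrite /divsum /= big_cat big_map /= big1_seq ?add0r.
  rewrite mulr_sumr.
  apply: eq_big => [m|m _]; last by rewrite natrM invfM mulrCA.
  by rewrite dvdn_pmul2l// prime_gt0//; case/desc_prime_seq_cons: dqs.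
move=> m /andP[qdm /(subset_prods_ndvd _ _ _ dqs)/negP[]].
by apply: dvdn_trans qdm; rewrite dvdn_mulr.
Qed.

(** With x and y the two inner sums, [d] contributes d(x + y/q)^2 and [q * d] contributes qd(y/q)^2
    = d y^2/q. *)
Lemma qform_cons lam q qs : desc_prime_seq (q :: qs) ->
  qform lam (q :: qs) = \sum_(d <- subset_prods qs) d%:R *
    ((divsum lam qs d + q%:R^-1 * divsum (fun m => lam (q * m)%N) qs d) ^+ 2
     + q%:R^-1 * divsum (fun m => lam (q * m)%N) qs d ^+ 2).
Proof.
move=> dqs; rewrite /qform /= big_cat big_map /= -big_split /=.
rewrite big_seq [RHS]big_seq; apply: eq_bigr => d ds.
rewrite divsum_cons// divsum_consM// natrM.
have q0 : q%:R != 0 :> R.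
  by rewrite pnatr_eq0 -lt0n prime_gt0//; case/desc_prime_seq_cons: dqs.
by field.
Qed.

Lemma qform_ext lam mu qs : {in subset_prods qs, lam =1 mu} ->
  qform lam qs = qform mu qs.
Proof.
move=> e; apply: eq_bigr => d _; congr (_ * _ ^+ 2); rewrite /divsum.
by rewrite big_seq_cond [RHS]big_seq_cond; apply: eq_bigr => m /andP[/e->].
Qed.

Lemma qformN lam qs : qform (fun m => - lam m) qs = qform lam qs.
Proof.
apply: eq_bigr => d _; rewrite -[in RHS]sqrrN /divsum -sumrN.
by congr (_ * _ ^+ 2); apply: eq_bigr => m _; rewrite mulNr.
Qed.

Lemma qformD lam mu qs :
  qform (fun m => lam m + mu m) qs <= 2 * qform lam qs + 2 * qform mu qs.
Proof.
rewrite /qform !mulr_sumr -big_split /=; apply: ler_sum => d _.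
have -> : divsum (fun m => lam m + mu m) qs d = divsum lam qs d + divsum mu qs d.
  by rewrite /divsum -big_split /=; apply: eq_bigr => m _; rewrite mulrDl.
rewrite !(mulrCA 2) -mulrDr ler_wpM2l//.
by have := sqr_ge0 (divsum lam qs d - divsum mu qs d); nra.
Qed.

(* [2 x y / q <= (2 x^2 + y^2 / 2) / q]; the ratio 4 of these coefficients is
   the gain per chosen prime in [qform_trunc_err_le]. *)
Lemma qform_cons_le lam q qs : desc_prime_seq (q :: qs) ->
  qform lam (q :: qs) <= (1 + 2 / q%:R) * qform lam qs +
    (3 / 2 / q%:R + q%:R^-1 ^+ 2) * qform (fun m => lam (q * m)%N) qs.
Proof.
move=> dqs; rewrite qform_cons// /qform !mulr_sumr -big_split /=.
apply: ler_sum => d _; set x := divsum lam qs d; set y := divsum _ qs d.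
rewrite !(mulrCA _ d%:R) -mulrDr ler_wpM2l//.
have : 0 <= q%:R^-1 * (2 * x - y) ^+ 2 by rewrite mulr_ge0 ?sqr_ge0 ?invr_ge0.
set u := q%:R^-1; lra.
Qed.

End QuadraticForm.

Arguments divsum {R} lam qs d.
Arguments qform {R} lam qs.

(** * Truncated weights *)

Lemma primes_mul_gt q m : prime q -> (0 < m)%N -> {in primes m, forall p, (p < q)%N} ->
  primes (q * m) = rcons (primes m) q.
Proof.
move=> pq m0 gtq; apply: (irr_sorted_eq ltn_trans ltnn).
- exact: sorted_primes.
- case: (primes m) (sorted_primes m) gtq => //= x s xs gtq.
  by rewrite rcons_path xs gtq ?mem_last.
- move=> p; rewrite mem_rcons inE primesM ?(prime_gt0 pq)//.
  by rewrite primes_prime// mem_seq1.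
Qed.

Lemma mobius_mul_gt q m : prime q -> (0 < m)%N -> {in primes m, forall p, (p < q)%N} ->
  mobius (q * m) = - mobius m.
Proof.
move=> pq m0 gtq; rewrite /mobius /squarefree primes_mul_gt// size_rcons.
rewrite muln_gt0 (prime_gt0 pq) m0 /= all_rcons lognM ?(prime_gt0 pq)//.
have qm : logn q m = 0%N.
  apply/eqP; rewrite -leqn0 leqNgt logn_gt0; apply/negP => /gtq.
  by rewrite ltnn.
rewrite qm addn0 logn_prime// eqxx /=.
rewrite (_ : all _ _ = all (fun p => logn p m == 1%N) (primes m)); last first.
  apply: eq_in_all => p pm; rewrite lognM ?(prime_gt0 pq)// logn_prime//.
  by rewrite (ltn_eqF (gtq _ pm)) add0n.
by case: ifP => _; rewrite ?oppr0// exprS mulN1r.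
Qed.

(** Since mu(qm) = -mu(m), here y = -x in [qform_cons], and each prime contributes (1 - 1/q)^2 +
    1/q. *)
Lemma qform_mobius (R : realFieldType) qs : desc_prime_seq qs ->
  qform (fun m => (mobius m)%:~R : R) qs =
  \prod_(q <- qs) (1 - q%:R^-1 + q%:R^-1 ^+ 2).
Proof.
elim: qs => [_|q qs IH dqs].
  rewrite /qform /divsum /= big_nil !big_seq1 big_cons big_nil dvdnn.
  by rewrite divr1 addr0 !expr1n mulr1.
have [pq gtq dqs'] := desc_prime_seq_cons _ _ dqs.
rewrite qform_cons// big_cons -IH//.
rewrite /qform mulr_sumr; apply: eq_bigr => d _.
have -> : divsum (fun m => (mobius (q * m))%:~R) qs d =
          - divsum (fun m => (mobius m)%:~R : R) qs d.
  rewrite /divsum -sumrN big_seq_cond [RHS]big_seq_cond.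
  apply: eq_bigr => m /andP[ms _].
  have [m0 sm] := subset_prods_primes _ _ dqs' ms.
  by rewrite mobius_mul_gt// ?mulrNz ?mulNr// => p /sm /(allP gtq).
by ring.
Qed.

Section Truncation.
Variables (R : realType) (t : nat -> bool) (beta D : R).

(* [t m] says that the condition of index [m] is imposed: odd [m] for the upper
   weights, even [m] for the lower ones. The primes [l] are those of the remaining factor, when [r]
   larger primes with product [c] have already been chosen. *)
Fixpoint admissible (c : R) (r : nat) (l : seq nat) : bool :=
  if l is p :: l' then
    (t r.+1 ==> (c * p%:R * p%:R `^ beta < D)) && admissible (c * p%:R) r.+1 l'
  else true.

(** Turns the recursion, suited to induction on the primes, into the indexed conditions of
    [beta_cond]; the sieve weights are the case [c = 1], [r = 0]. *)
Lemma admissible_all c r l : admissible c r l =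
  all (fun m => t (r + m) ==>
        (c * (\prod_(p <- take m l) p)%N%:R * (nth 0%N l m.-1)%:R `^ beta < D))
    (iota 1 (size l)).
Proof.
elim: l c r => //= p l IH c r; rewrite addn1 take0 big_seq1; congr (_ && _).
rewrite IH (iotaDl 1 1) all_map; apply: eq_in_all => -[|m]; rewrite mem_iota//.
by rewrite /= big_cons natrM mulrA (addSnnS r).
Qed.

Definition trunc_weight c r m : R :=
  if admissible c r (desc_primes m) then (mobius m)%:~R else 0.

(** As [q] exceeds every prime of [m], it is tested first; what remains is a weight of the same
    family, so the recursion stays inside the family. *)
Lemma trunc_weight_mul c r q qs m : desc_prime_seq (q :: qs) ->
  m \in subset_prods qs ->
  trunc_weight c r (q * m) =
    if t r.+1 ==> (c * q%:R * q%:R `^ beta < D)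
    then - trunc_weight (c * q%:R) r.+1 m else 0.
Proof.
move=> /desc_prime_seq_cons[pq /allP gtq dqs] /subset_prods_primes[]// m0 sm.
have {}gtq : {in primes m, forall p, (p < q)%N} by move=> p /sm/gtq.
rewrite /trunc_weight mobius_mul_gt// /desc_primes primes_mul_gt// rev_rcons /=.
by case: (t _ ==> _) => //=; case: ifP => _; rewrite ?oppr0 ?mulrNz.
Qed.

Definition trunc_err c r m : R := trunc_weight c r m - (mobius m)%:~R.

Hypothesis beta8 : 8 <= beta.
Hypothesis tS : forall r, t r.+1 = ~~ t r.
Variable z : R.
Hypothesis z1 : 1 <= z.

(* No condition can fail at the prime of index [k.+1] (counting from 1) when
   that prime is below [cutoff k]. *)
Definition cutoff (k : nat) : R := z `^ ((7 / 8) ^+ k).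

Lemma cutoff_ge1 k : 1 <= cutoff k.
Proof.
rewrite -(powRr0 z) /cutoff ler_powR// exprn_ge0//; lra.
Qed.

Lemma cutoffS k : cutoff k.+1 = cutoff k `^ (7 / 8).
Proof. by rewrite /cutoff exprSr powRrM. Qed.

(** Two steps multiply the exponent by 49/64, and 49(beta + 1) <= 64(beta - 1) once 15 beta >= 113.
    Two steps are taken because every other index carries a condition. *)
Lemma cutoffSS_powR_le k :
  cutoff k.+2 `^ (beta + 1) <= cutoff k `^ (beta - 1).
Proof.
rewrite !cutoffS -2!powRrM ler_powR ?cutoff_ge1//; have := beta8; lra.
Qed.

(* For [q <= cutoff r] the bound before [q] suffices; for [q > cutoff r] the
   condition passed at [q] does. *)
Lemma level_step c r q q' : 0 < c -> 0 <= q' -> q' <= q ->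
  c * cutoff r `^ (beta + 1) <= D -> c * q * q `^ beta < D ->
  c * q * q' * cutoff r.+2 `^ (beta + 1) <= D.
Proof.
move=> c0 q'0 q'q cD cqD; have b8 := beta8; have w1 := cutoff_ge1 r.
have Xw := cutoffSS_powR_le r.
have X0 : 0 <= cutoff r.+2 `^ (beta + 1) by exact: powR_ge0.
move: (cutoff r.+2 `^ _) Xw X0 => X; move: (cutoff r) w1 cD => w w1 cD Xw X0.
have q0 : 0 <= q by lra.
apply: (@le_trans _ _ (c * (q * q * w `^ (beta - 1)))).
  by rewrite -!mulrA ler_wpM2l ?(ltW c0)// ler_wpM2l// ler_pM.
have [qw|wq] := leP q w.
  apply: le_trans cD; rewrite ler_wpM2l ?(ltW c0)//.
  have w0 : 0 <= w by lra.
  have -> : w `^ (beta + 1) = w * w * w `^ (beta - 1).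
    rewrite -(mulr_powRB1 w0) ?addrK; last lra.
    by rewrite -(mulr_powRB1 w0) ?mulrA//; lra.
  rewrite ler_wpM2r ?powR_ge0//.
  by apply: ler_pM.
apply: (le_trans _ (ltW cqD)); rewrite -!mulrA ler_wpM2l ?(ltW c0)//.
rewrite ler_wpM2l// -[in leRHS](mulr_powRB1 q0); last lra.
rewrite ler_wpM2l// ge0_ler_powR ?nnegrE ?(ltW wq)//; lra.
Qed.

(* It forces the next prime at which an imposed condition fails to be at least
   the corresponding [cutoff]. *)
Definition level_inv (c : R) (r : nat) (qs : seq nat) : Prop :=
  if t r.+1 then c * cutoff r `^ (beta + 1) <= D : Prop
  else {in qs, forall q : nat, c * q%:R * cutoff r.+1 `^ (beta + 1) <= D}.

(** Above the cutoff this is (1 + 2/p) + 4(3/(2p) + 1/p^2), the coefficients of [qform_cons_le] with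
    the second one weighted by 4; below, it is the factor of [qform_mobius]. *)
Definition local_factor (k p : nat) : R :=
  if cutoff k <= p%:R then 1 + 8 / p%:R + 4 * p%:R^-1 ^+ 2
  else 1 - p%:R^-1 + p%:R^-1 ^+ 2.

(** The value 0 when no prime reaches the cutoff is what makes [err_bound_cons] true: a nonzero
    bound forces any larger prime past the cutoff. *)
Definition err_bound (k : nat) (qs : seq nat) : R :=
  if has (fun p => cutoff k <= p%:R) qs then \prod_(p <- qs) local_factor k p
  else 0.

Lemma local_factor_ge k p : 1 - p%:R^-1 + p%:R^-1 ^+ 2 <= local_factor k p.
Proof.
rewrite /local_factor; case: ifP => // _.
have : 0 <= p%:R^-1 :> R by rewrite invr_ge0.
by set u := p%:R^-1; nra.
Qed.

Lemma mobius_factor_ge0 (p : nat) : 0 <= 1 - p%:R^-1 + p%:R^-1 ^+ 2 :> R.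
Proof. by set u := p%:R^-1; nra. Qed.

Lemma local_factor_ge0 k p : 0 <= local_factor k p.
Proof. exact: le_trans (mobius_factor_ge0 p) (local_factor_ge k p). Qed.

Lemma err_bound_ge0 k qs : 0 <= err_bound k qs.
Proof.
by rewrite /err_bound; case: ifP => // _; apply: prodr_ge0 => p _;
  exact: local_factor_ge0.
Qed.

Lemma err_bound_cons k q qs : all (gtn q) qs ->
  (1 + 8 / q%:R + 4 * q%:R^-1 ^+ 2) * err_bound k qs <= err_bound k (q :: qs).
Proof.
move=> /allP gtq; rewrite {1}/err_bound; case: ifP => [/hasP[p pqs kp]|_].
  have kq : cutoff k <= q%:R.
    by apply: le_trans kp _; rewrite ler_nat ltnW//; exact: gtq.
  by rewrite /err_bound /= kq big_cons /local_factor kq.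
by rewrite mulr0 err_bound_ge0.
Qed.

(** Induction on the primes, largest first. Choosing [q] raises [r], and the factor 4 gained by
    [4 ^+ r] is the weight built into [local_factor]; a failure at [q] is paid for by the term k =
    r. *)
Lemma qform_trunc_err_le N qs c r : desc_prime_seq qs -> 0 < c ->
  level_inv c r qs ->
  (r + size qs <= N)%N ->
  qform (trunc_err c r) qs <=
    4 ^+ r * \sum_(r <= k < N) (4 ^+ k.+1)^-1 * err_bound k qs.
Proof.
elim: qs c r => [|q qs IH] c r dqs c0 inv sN.
  rewrite /qform /divsum /= !big_seq1 big_cons big_nil /trunc_err /trunc_weight /=.
  rewrite subrr mul0r addr0 expr0n mulr0 mulr_ge0 ?exprn_ge0//.
  by apply: sumr_ge0 => k _; rewrite mulr_ge0 ?err_bound_ge0 ?invr_ge0 ?exprn_ge0.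
have [pq gtq dqs'] := desc_prime_seq_cons _ _ dqs.
have q0 : 0 < q%:R :> R by rewrite ltr0n prime_gt0.
set u : R := q%:R^-1; have u0 : 0 <= u by rewrite invr_ge0 ltW.
pose B r' qs' := \sum_(r' <= k < N) (4 ^+ k.+1)^-1 * err_bound k qs'.
have B0 r' qs' : 0 <= B r' qs'.
  by apply: sumr_ge0 => k _; rewrite mulr_ge0 ?err_bound_ge0 ?invr_ge0 ?exprn_ge0.
have four n : 0 <= 4 ^+ n :> R by rewrite exprn_ge0.
have rN : (r < N)%N by rewrite (leq_trans _ sN)//= addnS ltnS leq_addr.
have Bcons : (1 + 8 * u + 4 * u ^+ 2) * B r qs <= B r (q :: qs).
  rewrite /B mulr_sumr; apply: ler_sum => k _; rewrite mulrCA.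
    by rewrite ler_wpM2l ?invr_ge0 ?exprn_ge0 ?err_bound_cons.
have inv1 : level_inv c r qs.
  move: inv; rewrite /level_inv; case: ifP => // _ inv p pqs.
  by rewrite inv// inE pqs orbT.
have IH1 := IH c r dqs' c0 inv1 (leq_trans (leq_add (leqnn r) (leqnSn _)) sN).
apply: le_trans (qform_cons_le _ _ _ _ dqs) _.
rewrite -/u -/(B r qs) -/(B r (q :: qs)) in IH1 *.
have [pass|] := boolP (t r.+1 ==> (c * q%:R * q%:R `^ beta < D)).
  rewrite (@qform_ext _ (fun m => trunc_err c r (q * m)%N)
    (fun m => - trunc_err (c * q%:R) r.+1 m)); last first.
    move=> m ms; rewrite /trunc_err (trunc_weight_mul _ _ _ qs)// pass.
    have [m0 sm] := subset_prods_primes _ _ dqs' ms.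
    rewrite mobius_mul_gt// ?mulrNz /= 1?opprD ?opprK// => p /sm.
    by move/(allP gtq).
  rewrite qformN.
  (* Imposed indices alternate with free ones: after an imposed one [level_step] bounds every later
     prime, after a free one the invariant at [q] is already the required bound. *)
  have inv2 : level_inv (c * q%:R) r.+1 qs.
    move: inv pass; rewrite /level_inv (tS r.+1); case: (t r.+1) => /= inv pass.
      move=> p pqs; apply: level_step => //.
      by rewrite ler_nat ltnW//; apply: (allP gtq).
    by apply: inv; rewrite inE eqxx.
  have := IH (c * q%:R) r.+1 dqs' (mulr_gt0 c0 q0) inv2.
  rewrite addSnnS => /(_ sN); rewrite -/(B r.+1 qs) => IH2.
  have BS : B r.+1 qs <= B r qs.
    rewrite [leRHS](big_ltn rN) lerDr mulr_ge0 ?invr_ge0//.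
    exact: err_bound_ge0.
  have {}IH2 := le_trans IH2 (ler_wpM2l (four r.+1) BS).
  rewrite exprS in IH2.
  apply: le_trans (ler_wpM2l (four r) Bcons).
  have h1 : 0 <= 1 + 2 * u by lra.
  have h2 : 0 <= 3 / 2 * u + u ^+ 2 by nra.
  have := lerD (ler_wpM2l h1 IH1) (ler_wpM2l h2 IH2).
  move=> /le_trans; apply.
  by move: (4 ^+ r) (B r qs) => F G; lra.
rewrite negb_imply => /andP[tr]; rewrite /level_inv tr in inv; rewrite -leNgt => fail.
(* If [q] were below the cutoff, c q^(beta + 1) would be below [D] by the invariant, so the
   condition would hold. *)
have rq : cutoff r <= q%:R.
  rewrite leNgt; apply/negP => qr; move: fail; rewrite leNgt => /negP[].
  apply: lt_le_trans inv; rewrite -mulrA ltr_pM2l//.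
  have b8 := beta8; have b0 : 0 < beta + 1 by lra.
  rewrite -[in ltLHS](addrK 1 beta) (mulr_powRB1 (ltW q0))//.
  by apply: gt0_ltr_powR; rewrite ?nnegrE ?(ltW q0) ?powR_ge0.
rewrite (@qform_ext _ (fun m => trunc_err c r (q * m)%N)
  (fun m => (mobius m)%:~R)); last first.
  move=> m ms; rewrite /trunc_err (trunc_weight_mul _ _ _ qs)//.
  rewrite tr /= ltNge fail /=.
  have [m0 sm] := subset_prods_primes _ _ dqs' ms.
  rewrite mobius_mul_gt// ?mulrNz ?opprK ?add0r// => p /sm.
  by move/(allP gtq).
rewrite qform_mobius//.
pose L := \prod_(p <- qs) local_factor r p.
have UL : \prod_(p <- qs) (1 - p%:R^-1 + p%:R^-1 ^+ 2) <= L.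
  by apply: ler_prod => p _; rewrite mobius_factor_ge0 local_factor_ge.
have EL : err_bound r qs <= L.
  by rewrite /err_bound; case: ifP => // _;
    apply: prodr_ge0 => p _; exact: local_factor_ge0.
(* The isolated term k = r carries the weight 1/4, and (1 + 8u + 4u^2)/4 = (1 + 2u)/4 + (3u/2 + u^2)
   pays exactly for its old share and for the new Moebius form. *)
have Bsplit qs' : 4 ^+ r * B r qs' = err_bound r qs' / 4 + 4 ^+ r * B r.+1 qs'.
  rewrite /B (big_ltn rN) mulrDr exprS invfM; congr (_ + _).
  by field; rewrite expf_neq0 ?pnatr_eq0.
rewrite Bsplit in IH1; rewrite Bsplit.
have E1 : err_bound r (q :: qs) = (1 + 8 * u + 4 * u ^+ 2) * L.
  by rewrite /err_bound /= rq big_cons /local_factor rq.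
rewrite E1.
have Bcons1 : (1 + 8 * u + 4 * u ^+ 2) * B r.+1 qs <= B r.+1 (q :: qs).
  rewrite /B mulr_sumr; apply: ler_sum => k _; rewrite mulrCA.
    by rewrite ler_wpM2l ?invr_ge0 ?exprn_ge0 ?err_bound_cons.
have := ler_wpM2l (four r) Bcons1.
have : 0 <= 4 ^+ r * B r.+1 qs by rewrite mulr_ge0 ?exprn_ge0.
rewrite mulrCA.
set X := 4 ^+ r * B r.+1 qs in IH1 *; set Y := 4 ^+ r * _.
set U := \prod_(p <- qs) _ in UL *.
set E := err_bound r qs in EL IH1.
have : 0 <= U by apply: prodr_ge0 => p _; exact: mobius_factor_ge0.
move=> U0 X0 XY.
have h1 : (1 + 2 * u) * qform (trunc_err c r) qs <= (1 + 2 * u) * (L / 4 + X).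
  rewrite ler_wpM2l//; lra.
have h2 : (3 / 2 * u + u ^+ 2) * U <= (3 / 2 * u + u ^+ 2) * L.
  rewrite ler_wpM2l//; nra.
have h3 : 0 <= (6 * u + 4 * u ^+ 2) * X by rewrite mulr_ge0//; nra.
lra.
Qed.
End Truncation.

(** * Mertens' first theorem *)

Section Mertens.
Variable R : realType.
Implicit Types (n p k : nat) (s : seq nat).

Lemma ler_sum_subset (T : eqType) (s s' : seq T) (f : T -> R) :
  uniq s -> uniq s' -> {subset s <= s'} -> (forall i, 0 <= f i) ->
  \sum_(i <- s) f i <= \sum_(i <- s') f i.
Proof.
move=> us us' ss' f0; rewrite (perm_big [seq i <- s' | i \in s]) /=.
  by rewrite big_filter big_mkcond; apply: ler_sum => i _; case: ifP.
apply: uniq_perm => //; first exact: filter_uniq.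
move=> i; rewrite mem_filter; case: (boolP (i \in s)) => //= /ss'->//.
Qed.

Lemma lnn_ge0 n : 0 <= ln n%:R :> R.
Proof.
by case: n => [|n]; [rewrite ln0 | rewrite ln_ge0// ler1n].
Qed.

Lemma ln_prime_factors n N : (0 < n < N)%N ->
  ln n%:R = \sum_(0 <= p < N | prime p) (logn p n)%:R * ln p%:R :> R.
Proof.
case: N => [|N]; first by rewrite andbF.
move=> /andP[n0 nN]; rewrite -{1}(partnT n0) (widen_partn _ (nN : (n <= N)%N)) natr_prod.
apply: expR_inj; rewrite lnK; last first.
  rewrite posrE prodr_gt0// => p _.
  have [->|p0] := posnP p; first by rewrite ltr0n expn_gt0 /logn.
  by rewrite ltr0n expn_gt0 p0.
rewrite expR_sum [RHS]big_mkcond; apply: eq_bigr => p _.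
have [pp|np] := boolP (prime p); last by rewrite /logn (negbTE np) expn0.
by rewrite expRM_natl lnK ?posrE ?ltr0n ?prime_gt0// natrX.
Qed.

Lemma logn_fact_small p n : (n < p)%N -> logn p n`! = 0%N.
Proof.
move=> np; have [pp|np'] := boolP (prime p); last by rewrite /logn (negbTE np').
rewrite logn_fact// big_nat big1// => k /andP[k0 _].
rewrite divn_small// (leq_trans np)// -{1}(expn1 p) leq_exp2l//.
exact: prime_gt1.
Qed.

Lemma ln_fact_primes n : (0 < n)%N ->
  ln n`!%:R = \sum_(0 <= p < n.+1 | prime p) (logn p n`!)%:R * ln p%:R :> R.
Proof.
move=> n0; rewrite (@ln_prime_factors _ n`!.+1) ?fact_gt0 ?ltnSn//.
rewrite (@big_cat_nat _ _ _ n.+1) ?ltnS ?fact_geq//=.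
rewrite [X in _ + X]big_nat_cond [X in _ + X]big1 ?addr0// => p.
by move=> /andP[/andP[np _] _]; rewrite logn_fact_small ?mul0r.
Qed.

Lemma bin_le_exp2 n k : ('C(n, k) <= 2 ^ n)%N.
Proof.
elim: n k => [|n IH] [|k]; rewrite ?bin0 ?expn_gt0//.
by rewrite binS expnS mul2n -addnn leq_add.
Qed.

(** Every prime in (k, 2k] divides C(2k, k) <= 4^k; strong induction then passes from ceil(n/2) to
    n. *)
Lemma chebyshev_theta n :
  \sum_(0 <= p < n.+1 | prime p) ln p%:R <= n%:R * (4 * ln 2) :> R.
Proof.
have l2 : 0 <= ln 2 :> R by rewrite (lnn_ge0 2).
have dbl k : \sum_(0 <= p < (k.*2).+1 | prime p) ln p%:R <=
    \sum_(0 <= p < k.+1 | prime p) ln p%:R + k%:R * (2 * ln 2) :> R.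
  rewrite (@big_cat_nat _ _ _ k.+1) ?ltnS -?addnn ?leq_addr//= lerD2l.
  have C0 : (0 < 'C(k + k, k))%N by rewrite bin_gt0 leq_addr.
  apply: (@le_trans _ _ (ln 'C(k + k, k)%:R)); last first.
    have -> : k%:R * (2 * ln 2) = ln (2 ^ (k + k))%:R :> R.
      by rewrite natrX lnXn// -[RHS]mulr_natl natrD; ring.
    by rewrite ler_ln ?posrE ?ltr0n ?expn_gt0// ler_nat bin_le_exp2.
  (* The range ends beyond both the binomial coefficient, as the factorization requires, and 2k, so
     that the block (k, 2k] can be cut out. *)
  rewrite (@ln_prime_factors _ ('C(k + k, k) + (k + k).+1).+1); last first.
    by rewrite C0 ltnS leq_addr.
  rewrite (@big_cat_nat _ _ _ k.+1 0) ?ltnS//=; last by lia.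
  rewrite [X in _ <= _ + X](@big_cat_nat _ _ _ (k + k).+1) ?ltnS/=; [|lia|lia].
  rewrite -[leLHS]addr0 -[leLHS]add0r !lerD//.
  - by apply: sumr_ge0 => p _; rewrite mulr_ge0 ?lnn_ge0.
  - rewrite big_nat_cond [leRHS]big_nat_cond.
    apply: ler_sum => p /andP[/andP[kp pk] pp].
    rewrite ler_peMl ?lnn_ge0// ler1n logn_gt0 mem_primes pp C0 /=.
    have pf : (p %| (k + k)`!)%N by rewrite dvdn_fact// prime_gt0.
    have npk : ~~ (p %| k`!)%N.
      apply/negP => pk'; have : (0 < logn p k`!)%N.
        by rewrite logn_gt0 mem_primes pp fact_gt0.
      by rewrite logn_fact_small.
    move: pf; rewrite -(bin_fact (leq_addr k k)) addnK !Euclid_dvdM//.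
    by rewrite (negbTE npk) !orbF.
  - by apply: sumr_ge0 => p _; rewrite mulr_ge0 ?lnn_ge0.
elim/ltn_ind: n => n IH.
have [n1|n1] := leqP n 1.
  rewrite big_nat_cond big1 ?mulr_ge0// => p /andP[/andP[_ pn] pp].
  by have := prime_gt1 pp; lia.
pose k := uphalf n.
have kn : (k < n)%N by rewrite /k; lia.
have nk : (n <= k.*2)%N by rewrite /k; lia.
apply: (@le_trans _ _ (\sum_(0 <= p < (k.*2).+1 | prime p) ln p%:R)).
  rewrite [leRHS](@big_cat_nat _ _ _ n.+1)//= lerDl.
  by apply: sumr_ge0 => p _; exact: lnn_ge0.
apply: le_trans (dbl k) _; apply: le_trans (lerD (IH _ kn) (lexx _)) _.
rewrite !mulrA -!mulrDl ler_wpM2r//.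
(* Equality holds at n = 3, so 4 is the least constant that this halving argument allows. *)
have : (k * 4 + k * 2 <= n * 4)%N by rewrite /k; lia.
by rewrite -(ler_nat R) natrD !natrM.
Qed.

(** Compares ln n! <= n ln n with the exponent bound v_p(n!) >= floor(n/p) > n/p - 1; the loss, a
    sum of ln p, is absorbed by [chebyshev_theta]. *)
Lemma mertens_upper n : (0 < n)%N ->
  \sum_(0 <= p < n.+1 | prime p) ln p%:R / p%:R <= ln n%:R + 4 * ln 2 :> R.
Proof.
move=> n0; have n0R : 0 < n%:R :> R by rewrite ltr0n.
have le_fact m : ln m`!%:R <= m%:R * ln m%:R :> R.
  elim: m => [|m IH]; first by rewrite mul0r fact0 ln1.
  rewrite factS natrM lnM ?posrE ?ltr0n ?fact_gt0//.
  rewrite -[X in _ <= X * _]natr1 mulrDl mul1r addrC lerD2r.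
  apply: le_trans IH _; rewrite ler_wpM2l//.
  case: m => [|m]; first by rewrite ln0 ?lnn_ge0.
  by rewrite ler_ln ?posrE ?ltr0n// ler_nat.
have h : \sum_(0 <= p < n.+1 | prime p) (n%:R * (ln p%:R / p%:R) - ln p%:R)
    <= n%:R * ln n%:R :> R.
  apply: le_trans (le_fact n); rewrite ln_fact_primes//.
  rewrite big_nat_cond [leRHS]big_nat_cond.
  apply: ler_sum => p /andP[/andP[_ pn] pp].
  have p0 : 0 < p%:R :> R by rewrite ltr0n prime_gt0.
  have -> : n%:R * (ln p%:R / p%:R) - ln p%:R = (n%:R / p%:R - 1) * ln p%:R :> R.
    by ring.
  rewrite ler_wpM2r ?lnn_ge0// lerBlDr natr1 ler_pdivrMr// -natrM ler_nat.
  apply: leq_trans (ltnW (ltn_ceil n (prime_gt0 pp))) _.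
  rewrite leq_mul2r ltnS logn_fact// big_ltn ?expn1 ?leq_addr ?orbT//.
rewrite sumrB -mulr_sumr in h.
have := chebyshev_theta n => th.
rewrite -(ler_pM2l n0R); lra.
Qed.

Lemma lnS_sub_le n : (0 < n)%N -> ln n.+1%:R - ln n%:R <= n%:R^-1 :> R.
Proof.
move=> n0; have n0R : 0 < n%:R :> R by rewrite ltr0n.
rewrite -ln_div ?posrE ?ltr0n// -natr1 mulrDl mulfV ?gt_eqF// mul1r.
by rewrite le_ln1Dx// (lt_trans (_ : -1 < 0)) ?invr_gt0// ltrN10.
Qed.

(** Compares n! >= (n/e)^n with v_p(n!) <= n/(p - 1) = n/p + n/(p(p - 1)). The 3 is 1 from the
    factorial plus 2 from the sum of ln p/(p(p - 1)). *)
Lemma mertens_lower n : (0 < n)%N ->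
  ln n%:R - 3 <= \sum_(0 <= p < n.+1 | prime p) ln p%:R / p%:R :> R.
Proof.
move=> n0; have n0R : 0 < n%:R :> R by rewrite ltr0n.
have fact_ge m : m%:R * ln m%:R - m%:R <= ln m`!%:R :> R.
  elim: m => [|m IH]; first by rewrite mul0r subr0 fact0 ln1.
  rewrite factS natrM lnM ?posrE ?ltr0n ?fact_gt0//.
  case: m IH => [|m] IH; first by rewrite ln1; lra.
  have := lnS_sub_le m.+1 isT; rewrite -(ler_pM2l (ltr0Sn R m)) mulfV ?pnatr_eq0// => h.
  by rewrite -[m.+2%:R]natr1; rewrite -[m.+2%:R]natr1 in h; lra.
(* The subtracted (ln m + 2)/m lets the induction close: its decrease at each step is at least the
   new term, prime or not. *)
have tail m : (0 < m)%N ->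
    \sum_(0 <= p < m.+1 | prime p) ln p%:R / (p%:R * (p%:R - 1)) <=
    2 - (ln m%:R + 2) / m%:R :> R.
  elim: m => // -[_ _|m IH _].
    rewrite big_nat_cond big1 ?ln1; first lra.
    by move=> p /andP[/andP[_ pn] pp]; have := prime_gt1 pp; lia.
  rewrite big_mkcond big_nat_recr//= -big_mkcond.
  apply: (le_trans (lerD (IH isT) (lexx _))).
  have h := lnS_sub_le m.+1 isT.
  have m0 : 0 < m.+1%:R :> R by rewrite ltr0n.
  set x : R := m.+1%:R in h m0 *; have -> : m.+2%:R = x + 1 by rewrite natr1.
  have x1 : 1 <= x by rewrite ler1n.
  have l0 : 0 <= ln (x + 1) by rewrite natr1 lnn_ge0.
  rewrite -[m.+2%:R]natr1 -/x in h; clearbody x.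
  apply: (@le_trans _ _ (2 - (ln x + 2) / x + ln (x + 1) / ((x + 1) * x))).
    rewrite lerD2l addrK; case: ifP => // _.
    by rewrite divr_ge0// mulr_ge0//; lra.
  rewrite -subr_ge0.
  have -> : 2 - (ln (x + 1) + 2) / (x + 1) -
      (2 - (ln x + 2) / x + ln (x + 1) / ((x + 1) * x)) =
      (2 - (x + 1) * (ln (x + 1) - ln x)) / (x * (x + 1)).
    by field; rewrite !gt_eqF//; lra.
  rewrite divr_ge0//; last by rewrite mulr_ge0//; lra.
  have : (x + 1) * (ln (x + 1) - ln x) <= (x + 1) * x^-1 by rewrite ler_wpM2l//; lra.
  have -> : (x + 1) * x^-1 = 1 + x^-1 by rewrite mulrDl mulfV ?mul1r ?gt_eqF.
  have : x^-1 <= 1 by rewrite invf_le1.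
  lra.
have geom p m : prime p ->
    \sum_(1 <= k < m.+1) (n %/ p ^ k)%:R <= n%:R / (p%:R - 1) :> R.
  move=> pp; have p1 : 1 < p%:R :> R by rewrite ltr1n prime_gt1.
  have p0 : 0 < p%:R :> R by lra.
  suff : \sum_(1 <= k < m.+1) (n %/ p ^ k)%:R <=
      n%:R / (p%:R - 1) * (1 - (p%:R ^+ m)^-1) :> R.
    move/le_trans; apply; rewrite ler_piMr ?divr_ge0//; first lra.
    by rewrite gerBl invr_ge0 exprn_ge0// ltW.
  elim: m => [|m IH]; first by rewrite big_geq// expr0 invr1 subrr mulr0.
  rewrite big_nat_recr//=; apply: le_trans (lerD IH (lexx _)) _.
  apply: (@le_trans _ _ (n%:R / (p%:R - 1) * (1 - (p%:R ^+ m)^-1) +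
                          n%:R / p%:R ^+ m.+1)).
    rewrite lerD2l ler_pdivlMr ?exprn_gt0// -natrX -natrM ler_nat.
    exact: leq_trunc_div.
  rewrite le_eqVlt; apply/orP; left; apply/eqP; rewrite exprS; field.
  by rewrite expf_neq0 ?gt_eqF//; lra.
have h : n%:R * ln n%:R - n%:R <= \sum_(0 <= p < n.+1 | prime p)
   (n%:R * (ln p%:R / p%:R) + n%:R * (ln p%:R / (p%:R * (p%:R - 1)))) :> R.
  apply: le_trans (fact_ge n) _; rewrite ln_fact_primes//.
  apply: ler_sum => p pp; rewrite logn_fact// natr_sum.
  apply: le_trans (ler_wpM2r (lnn_ge0 p) (geom p n pp)) _.
  have p1 : 1 < p%:R :> R by rewrite ltr1n prime_gt1.
  rewrite le_eqVlt; apply/orP; left; apply/eqP; field.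
  by rewrite !gt_eqF//; lra.
rewrite big_split -!mulr_sumr /= in h.
have : n%:R * \sum_(0 <= p < n.+1 | prime p) ln p%:R / (p%:R * (p%:R - 1))
    <= n%:R * 2 :> R.
  rewrite ler_wpM2l//; apply: le_trans (tail n n0) _.
  by rewrite gerBl divr_ge0// addr_ge0// lnn_ge0.
by move=> h2; rewrite -(ler_pM2l n0R); lra.
Qed.

(** The errors of the upper and lower bounds, plus ln 3 for replacing w by an integer m with w <=
    3m. *)
Definition mertens_const : R := 4 * ln 2 + 3 + ln 3.

Lemma mertens_const_ge0 : 0 <= mertens_const.
Proof.
by have := lnn_ge0 2; have := lnn_ge0 3; rewrite /mertens_const; lra.
Qed.

Lemma mertens_interval (w z : R) s : 2 <= w -> w <= z -> uniq s ->
  {in s, forall p, prime p && (w <= p%:R < z)} ->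
  \sum_(p <- s) ln p%:R / p%:R <= ln z - ln w + mertens_const.
Proof.
move=> w2 wz us sp; have z0 : 0 <= z by lra.
(* Subtracting 1 keeps the prime p = w when w is an integer; as m >= 1, still w < m + 2 <= 3m. *)
pose n := Num.truncn z; pose m := (Num.truncn w).-1.
have w_ge0 : 0 <= w by lra.
have tw : (2 <= Num.truncn w)%N by rewrite truncn_ge_nat.
have m0 : (0 < m)%N by rewrite /m; lia.
have mw : m.+1%:R <= w by rewrite /m prednK ?truncn_le//; lia.
have wm : w <= 3 * m%:R.
  apply: ltW; apply: (@lt_le_trans _ _ (Num.truncn w).+1%:R).
    exact: truncnS_gt.
  by rewrite -natrM ler_nat /m; lia.
have mn : (m <= n)%N.
  by rewrite /n truncn_ge_nat//; apply: le_trans wz; apply: le_trans mw; rewrite ler_nat.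
have nz : n%:R <= z by rewrite truncn_le.
have sub : \sum_(p <- s) ln p%:R / p%:R <=
    \sum_(m.+1 <= p < n.+1 | prime p) ln p%:R / p%:R :> R.
  rewrite -[leRHS]big_filter; apply: ler_sum_subset => //.
  - by rewrite filter_uniq// iota_uniq.
  - move=> p /sp /andP[pp /andP[wp pz]]; rewrite mem_filter pp mem_index_iota.
    rewrite -(ltr_nat R) (lt_le_trans _ wp) //=; last first.
      by apply: lt_le_trans mw; rewrite ltr_nat.
    by rewrite ltnS truncn_ge_nat// ltW.
  - by move=> p; rewrite divr_ge0 ?lnn_ge0.
apply: le_trans sub _.
have := mertens_upper n (leq_trans m0 mn); have := mertens_lower m m0.
rewrite (@big_cat_nat _ _ _ m.+1 0 n.+1)//=.
have : ln n%:R <= ln z.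
  by rewrite ler_ln ?posrE ?ltr0n ?(leq_trans m0 mn)//; lra.
have : ln w <= ln 3 + ln m%:R.
  by rewrite -lnM ?posrE ?ltr0n// ler_ln ?posrE ?mulr_gt0 ?ltr0n//; lra.
rewrite /mertens_const; lra.
Qed.

(** On the interval 1/p <= ln p/(p ln w), and ln z - ln w <= (ln w)/7 when z is at most one cutoff
    step above w. *)
Lemma reciprocal_interval (w z : R) s : 2 <= w -> w <= z ->
  ln z <= 8 / 7 * ln w -> uniq s ->
  {in s, forall p, prime p && (w <= p%:R < z)} ->
  \sum_(p <- s) p%:R^-1 <= 7^-1 + mertens_const / ln w.
Proof.
move=> w2 wz lwz us sp; have lw : 0 < ln w by rewrite ln_gt0//; lra.
rewrite -(ler_pM2l lw) mulrDr mulrCA mulfV ?gt_eqF// mulr1.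
apply: (@le_trans _ _ (\sum_(p <- s) ln p%:R / p%:R)).
  rewrite mulr_sumr big_seq [leRHS]big_seq; apply: ler_sum => p /sp.
  move=> /andP[pp /andP[wp _]]; rewrite ler_wpM2r ?invr_ge0//.
  by rewrite ler_ln ?posrE ?ltr0n ?prime_gt0//; lra.
apply: le_trans (mertens_interval w z s w2 wz us sp) _; lra.
Qed.
End Mertens.

(** * Summation over the stage of failure *)

Section Assembly.
Variables (R : realType) (z : R).
Hypothesis z1 : 1 <= z.
Local Notation cutoff := (cutoff R z).
Local Notation M := (mertens_const R).

Let cut1 k : 1 <= cutoff k. Proof. exact: cutoff_ge1. Qed.

Let ln_cutS k : ln (cutoff k.+1) = 7 / 8 * ln (cutoff k).
Proof. by rewrite cutoffS ln_powR. Qed.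

Let cut_le k : cutoff k.+1 <= cutoff k.
Proof. by rewrite cutoffS ler1_powR//; lra. Qed.

Let ln2_gt0 : 0 < ln 2 :> R.
Proof. by rewrite ln_gt0// ltr1n. Qed.

Let split_sum (s : seq nat) (w : R) : \sum_(p <- s) p%:R^-1 =
  \sum_(p <- [seq p <- s | w <= p%:R]) p%:R^-1 +
  \sum_(p <- [seq p <- s | p%:R < w]) p%:R^-1 :> R.
Proof.
rewrite (bigID (fun p : nat => w <= p%:R)) /= !big_filter; congr (_ + _).
by apply: eq_bigl => p; rewrite ltNge.
Qed.

Let cutoff0_nil (s : seq nat) :
  {in s, forall p, prime p && (cutoff 0 <= p%:R < z)} -> s = [::].
Proof.
case: s => // p s /(_ p); rewrite inE eqxx => /(_ isT)/andP[_ /andP[zp]].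
by rewrite ltNge -[z in X in X -> _](powRr1 (le_trans ler01 z1)) zp.
Qed.

(** The error M/ln(cutoff) grows by 8/7 per step, so all errors together are at most 1/(1 - 7/8) = 8
    times the last one. *)
Lemma reciprocal_cutoff_ge2 k (s : seq nat) : 2 <= cutoff k -> uniq s ->
  {in s, forall p, prime p && (cutoff k <= p%:R < z)} ->
  \sum_(p <- s) p%:R^-1 <= k%:R / 7 + 8 * M / ln (cutoff k).
Proof.
have M0 := mertens_const_ge0 R.
elim: k s => [|k IH] s c2 us sp.
  have -> : s = [::] by exact: cutoff0_nil sp.
  by rewrite big_nil mul0r add0r divr_ge0 ?mulr_ge0 ?ln_ge0.
have c2' : 2 <= cutoff k by apply: le_trans (cut_le k).
have lk : 0 < ln (cutoff k) by rewrite ln_gt0//; lra.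
rewrite (split_sum s (cutoff k)).
apply: le_trans (lerD (IH _ c2' (filter_uniq _ us) _)
  (reciprocal_interval R (cutoff k.+1) (cutoff k) _ c2 (cut_le k) _
    (filter_uniq _ us) _)) _.
- by move=> p; rewrite mem_filter => /andP[-> /sp/andP[-> /andP[_ ->]]].
- by rewrite ln_cutS; lra.
- by move=> p; rewrite mem_filter => /andP[-> /sp/andP[-> /andP[-> _]]].
rewrite ln_cutS -natr1 le_eqVlt; apply/orP; left; apply/eqP; field.
by rewrite gt_eqF.
Qed.

(** Below 2 there are no primes, so only the step in which the cutoff crosses 2 is new; it costs one
    more M/ln 2. *)
Lemma reciprocal_cutoff k (s : seq nat) : uniq s ->
  {in s, forall p, prime p && (cutoff k <= p%:R < z)} ->
  \sum_(p <- s) p%:R^-1 <= k%:R / 7 + 9 * M / ln 2.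
Proof.
have M0 := mertens_const_ge0 R.
have strong j (s' : seq nat) : 2 <= cutoff j -> uniq s' ->
    {in s', forall p, prime p && (cutoff j <= p%:R < z)} ->
    \sum_(p <- s') p%:R^-1 <= j%:R / 7 + 8 * M / ln 2.
  move=> c2 us sp; apply: le_trans (reciprocal_cutoff_ge2 _ _ c2 us sp) _.
  rewrite lerD2l ler_wpM2l ?mulr_ge0// lef_pV2 ?posrE//.
    by rewrite ler_ln ?posrE//; lra.
  by rewrite ln_gt0//; lra.
have Mln : 0 <= M / ln 2 by rewrite divr_ge0// ltW.
elim: k s => [|k IH] s us sp.
  have -> : s = [::] by exact: cutoff0_nil sp.
  by rewrite big_nil mul0r add0r divr_ge0 ?mulr_ge0// ltW.
have [c2|c2] := leP 2 (cutoff k.+1).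
  by apply: le_trans (strong _ _ c2 us sp) _; lra.
have [ck|ck] := leP 2 (cutoff k); last first.
  apply: (@le_trans _ _ (k%:R / 7 + 9 * M / ln 2)).
    apply: IH => // p /sp/andP[pp /andP[_ ->]]; rewrite pp andbT /=.
    by apply: le_trans (ltW ck) _; rewrite ler_nat prime_gt1.
  by rewrite lerD2r ler_pM2r ?invr_gt0 ?ler_nat ?ltr0n.
rewrite (split_sum s (cutoff k)).
apply: le_trans (lerD (strong k _ ck (filter_uniq _ us) _)
  (reciprocal_interval R 2 (cutoff k) _ (lexx _) ck _
    (filter_uniq _ us) _)) _.
- by move=> p; rewrite mem_filter => /andP[-> /sp/andP[-> /andP[_ ->]]].
- have : ln (cutoff k.+1) <= ln 2 by rewrite ler_ln ?posrE//; have := cut1 k.+1; lra.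
  rewrite ln_cutS; lra.
- move=> p; rewrite mem_filter => /andP[-> /sp/andP[pp _]].
  by rewrite pp andbT ler_nat prime_gt1.
by rewrite -natr1; lra.
Qed.

(** * Euler factors compared with 1 - 1/p *)

Lemma sum_primes_pred_le1 (s : seq nat) : uniq s -> all prime s ->
  \sum_(p <- s) (p%:R * (p%:R - 1))^-1 <= 1 :> R.
Proof.
move=> us ps; pose N := \max_(p <- s) p.
have h n : \sum_(2 <= p < n.+2) (p%:R * (p%:R - 1))^-1 = 1 - n.+1%:R^-1 :> R.
  elim: n => [|n IH]; first by rewrite big_geq// invr1 subrr.
  rewrite big_nat_recr// [LHS]/= IH -[n.+2%:R]natr1 addrK.
  have n0 : n.+1%:R != 0 :> R by rewrite pnatr_eq0.
  have n1 : n.+1%:R + 1 != 0 :> R by rewrite natr1 pnatr_eq0.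
  by move: n0 n1; set x : R := n.+1%:R; move: x => x n0 n1; field; rewrite n0 n1.
apply: (@le_trans _ _ (\sum_(2 <= p < N.+2) (p%:R * (p%:R - 1))^-1)).
  apply: ler_sum_subset => //; first exact: iota_uniq.
    move=> p pin; rewrite mem_index_iota prime_gt1 ?(allP ps)//= ltnS.
    exact: leq_trans (leq_bigmax_seq p pin isT) (leqnSn _).
  move=> [|p]; first by rewrite mul0r invr0.
  by rewrite -[p.+1%:R]natr1 addrK invr_ge0 mulr_ge0 ?addr_ge0.
by rewrite h gerBl invr_ge0.
Qed.
Let one_sub_inv_ge0 p : prime p -> 0 <= 1 - p%:R^-1 :> R.
Proof. by move=> /prime_gt0 p0; rewrite subr_ge0 invf_le1 ?ler1n ?ltr0n. Qed.

(** The left side is exactly (1 - 1/p)(1 + 1/(p(p - 1))); the coefficient 5 only matches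
    [local_factor_le]. *)
Lemma mobius_factor_le p : prime p -> 1 - p%:R^-1 + p%:R^-1 ^+ 2 <=
  (1 - p%:R^-1) * expR (5 * (p%:R * (p%:R - 1))^-1) :> R.
Proof.
move=> pp; have p1 : 1 < p%:R :> R by rewrite ltr1n prime_gt1.
apply: (@le_trans _ _ ((1 - p%:R^-1) * (1 + 5 * (p%:R * (p%:R - 1))^-1))).
  rewrite -subr_ge0.
  have -> : (1 - p%:R^-1) * (1 + 5 * (p%:R * (p%:R - 1))^-1) -
      (1 - p%:R^-1 + p%:R^-1 ^+ 2) = 4 * p%:R^-1 ^+ 2 :> R.
    by field; rewrite !gt_eqF//; lra.
  by rewrite mulr_ge0 ?sqr_ge0.
by rewrite ler_wpM2l ?one_sub_inv_ge0// expR_ge1Dx.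
Qed.

(** With u = 1/p and v = u^2/(1 - u), (1 - u)(1 + u + v) = 1, so e^(u + v) undoes 1 - u. The rest is
    at most e^(8u + 4v), whence 9 = 8 + 1 and 5 = 4 + 1. *)
Lemma local_factor_le k p : prime p ->
  local_factor R z k p <= (1 - p%:R^-1) *
    expR (5 * (p%:R * (p%:R - 1))^-1 +
          if cutoff k <= p%:R then 9 * p%:R^-1 else 0).
Proof.
move=> pp; rewrite /local_factor; case: ifP => _; last first.
  by rewrite addr0 mobius_factor_le.
have p1 : 1 < p%:R :> R by rewrite ltr1n prime_gt1.
set u : R := p%:R^-1; set v : R := (_ * _)^-1.
have u1 : 0 < 1 - u by rewrite subr_gt0 invf_lt1//; lra.
have v0 : 0 < v by rewrite invr_gt0 mulr_gt0//; lra.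
have uv : (1 - u) * v = u ^+ 2.
  by rewrite /u /v; field; rewrite !gt_eqF//; lra.
have u0 : 0 < u by rewrite invr_gt0; lra.
have -> : 5 * v + 9 * u = (u + v) + (8 * u + 4 * v) by ring.
rewrite expRD [leRHS]mulrA.
have h1 : 1 <= (1 - u) * expR (u + v).
  apply: (@le_trans _ _ ((1 - u) * (1 + (u + v)))).
    by rewrite addrA mulrDr uv; lra.
  by rewrite ler_pM2l// expR_ge1Dx.
have h2 : 1 + 8 * u + 4 * u ^+ 2 <= expR (8 * u + 4 * v).
  by apply: le_trans (expR_ge1Dx _); nra.
by apply: (le_trans h2); rewrite ler_peMl ?expR_ge0.
Qed.

Lemma prod_mobius_factor_le (s : seq nat) : uniq s -> all prime s ->
  \prod_(p <- s) (1 - p%:R^-1 + p%:R^-1 ^+ 2) <=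
  expR 5 * \prod_(p <- s) (1 - p%:R^-1) :> R.
Proof.
move=> us /allP ps.
apply: (@le_trans _ _ (\prod_(p <- s)
    ((1 - p%:R^-1) * expR (5 * (p%:R * (p%:R - 1))^-1)))).
  rewrite big_seq [leRHS]big_seq; apply: ler_prod => p /ps pp.
  by rewrite mobius_factor_ge0 mobius_factor_le.
rewrite big_split /= -expR_sum mulrC ler_wpM2r//.
  by rewrite big_seq; apply: prodr_ge0 => p /ps/one_sub_inv_ge0.
rewrite ler_expR -mulr_sumr ger_pMr// sum_primes_pred_le1//.
exact/allP.
Qed.

Lemma err_bound_le k (s : seq nat) : uniq s ->
  {in s, forall p, prime p && (p%:R < z)} ->
  err_bound R z k s <=
  expR (5 + 9 * (k%:R / 7 + 9 * M / ln 2)) * \prod_(p <- s) (1 - p%:R^-1).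
Proof.
move=> us sp.
have V0 : 0 <= \prod_(p <- s) (1 - p%:R^-1) :> R.
  by rewrite big_seq; apply: prodr_ge0 => p /sp/andP[/one_sub_inv_ge0].
rewrite /err_bound; case: ifP => _; last by rewrite mulr_ge0 ?expR_ge0.
apply: (@le_trans _ _ (\prod_(p <- s) ((1 - p%:R^-1) *
    expR (5 * (p%:R * (p%:R - 1))^-1 +
          if cutoff k <= p%:R then 9 * p%:R^-1 else 0)))).
  rewrite big_seq [leRHS]big_seq; apply: ler_prod => p ps.
  rewrite local_factor_ge0 local_factor_le//.
  by case/andP: (sp p ps).
rewrite big_split /= -expR_sum mulrC ler_wpM2r// ler_expR big_split /=.
rewrite -mulr_sumr -big_mkcond -big_filter -mulr_sumr lerD//.
  rewrite ger_pMr// sum_primes_pred_le1//.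
  by apply/allP => p /sp/andP[].
rewrite ler_pM2l// reciprocal_cutoff ?filter_uniq// => p.
by rewrite mem_filter => /andP[-> /sp/andP[-> ->]].
Qed.

Lemma expR_9_7_lt : expR (9 / 7) <= 96 / 25 :> R.
Proof.
(* The inequality e^x <= 1/(1 - x) is too weak at 9/7, but at a sixteenth of it the 16th power stays
   below 4. *)
have -> : 9 / 7 = 16%:R * (9 / 112) :> R by field.
have h : expR (9 / 112) <= 112 / 103 :> R.
  rewrite -[9 / 112]opprK expRN -[leRHS]invrK invf_div.
  rewrite lef_pV2 ?posrE ?expR_gt0 ?divr_gt0//.
  by apply: le_trans (expR_ge1Dx _); lra.
rewrite expRM_natl; apply: (@le_trans _ _ ((112 / 103) ^+ 16)).
  by rewrite lerXn2r ?nnegrE ?expR_ge0 ?divr_ge0.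
lra.
Qed.

(** Term k is at most (24/25)^k/4 times a fixed quantity, because e^(9/7) <= 4 * 24/25; the
    geometric series sums to at most 25. *)
Lemma sum_err_bound_le N (s : seq nat) : uniq s ->
  {in s, forall p, prime p && (p%:R < z)} ->
  \sum_(0 <= k < N) (4 ^+ k.+1)^-1 * err_bound R z k s <=
  25 / 4 * expR (5 + 81 * M / ln 2) * \prod_(p <- s) (1 - p%:R^-1).
Proof.
move=> us sp; set K := expR (5 + _); set V := \prod_(p <- s) _.
have V0 : 0 <= V.
  by rewrite /V big_seq; apply: prodr_ge0 => p /sp/andP[/one_sub_inv_ge0].
have K0 : 0 <= K by exact: expR_ge0.
have geo : \sum_(0 <= k < N) (24 / 25) ^+ k = 25 * (1 - (24 / 25) ^+ N) :> R.
  elim: N => [|N IH]; first by rewrite big_geq// expr0 subrr mulr0.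
  by rewrite big_nat_recr//= IH exprS; lra.
apply: (@le_trans _ _ (\sum_(0 <= k < N) (24 / 25) ^+ k * (K * V / 4))).
  apply: ler_sum => k _.
  apply: le_trans (ler_wpM2l _ (err_bound_le k s us sp)) _.
    by rewrite invr_ge0 exprn_ge0.
  have -> : 5 + 9 * (k%:R / 7 + 9 * M / ln 2) =
      (5 + 81 * M / ln 2) + k%:R * (9 / 7) by ring.
  rewrite expRD expRM_natl -/K.
  apply: (@le_trans _ _ ((4 ^+ k.+1)^-1 * (K * (96 / 25) ^+ k * V))).
    rewrite ler_wpM2l ?invr_ge0 ?exprn_ge0// ler_wpM2r// ler_wpM2l//.
    by rewrite lerXn2r ?nnegrE ?expR_ge0 ?divr_ge0 ?expR_9_7_lt.
  have -> : 96 / 25 = 4 * (24 / 25) :> R by field.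
  rewrite exprMn exprS le_eqVlt; apply/orP; left; apply/eqP; field.
  by rewrite expf_neq0// pnatr_eq0.
rewrite -mulr_suml geo -subr_ge0.
have -> : 25 / 4 * K * V - 25 * (1 - (24 / 25) ^+ N) * (K * V / 4) =
  25 / 4 * (K * V * (24 / 25) ^+ N) by ring.
by rewrite !mulr_ge0 ?exprn_ge0 ?divr_ge0 ?invr_ge0.
Qed.

End Assembly.

(** * Specialization to the upper and lower beta-sieve weights *)

Theorem lemma6p18 (R : realType) (beta : R) (hbeta : 8 <= beta) :
  exists C : R, 0 < C /\
    forall (z D : R) (A : set nat) (lambda : nat -> R),
      2 <= z -> z <= D `^ (beta + 1)^-1 ->
      (forall p : nat, A p -> prime p) ->
      lambda = upper_beta_weight beta D \/ lambda = lower_beta_weight beta D ->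
      let P := prime_product A z in
      \sum_(d <- divisors P)
        d%:R * (\sum_(m <- divisors P | (d %| m)%N) lambda m / m%:R) ^+ 2
      <= C * \prod_(p <- primes P) (1 - p%:R^-1).
Proof.
pose K : R := expR (5 + 81 * mertens_const R / ln 2).
(* Twice the constant 25 K/4 for the error form plus twice e^5 for the Moebius form; the factors 2
   come from [qformD]. *)
exists (25 / 2 * K + 2 * expR 5); split.
  by rewrite !(addr_gt0, mulr_gt0, expR_gt0, invr_gt0).
move=> z D A lambda z2 zD Aprime hlam; cbv zeta.
set P := prime_product A z.
have z1 : 1 <= z by lra.
(* By the conventions for [powR], the power is 0 at D = 0 and 1 at D < 0, both contradicting z >=
   2. *)
have D0 : 0 < D.
  rewrite ltNge; apply/negP; rewrite le_eqVlt => /orP[/eqP D0|D0].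
    by move: zD; rewrite D0 powR0 ?invr_eq0 ?gt_eqF//; lra.
  by move: zD; rewrite lt0_powR1//; lra.
have zD1 : z `^ (beta + 1) <= D.
  have b1 : 0 < beta + 1 by lra.
  have := ge0_ler_powR (ltW b1) _ _ zD.
  rewrite -powRrM mulVf ?gt_eqF// powRr1 ?(ltW D0)// !nnegrE powR_ge0.
  by apply => //; lra.
pose ps := [seq p <- index_iota 0 (Num.truncn z).+1 | (p \in A) && (p%:R < z)].
have psP p : p \in ps -> prime p && (p%:R < z).
  rewrite mem_filter => /andP[/andP[pA ->] _]; rewrite andbT.
  by apply: Aprime; rewrite in_setE in pA.
have ps_sorted : sorted ltn ps.
  by rewrite sorted_filter ?iota_ltn_sorted//; exact: ltn_trans.
have ps_uniq : uniq ps by rewrite filter_uniq ?iota_uniq.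
have PE : P = (\prod_(p <- ps) p)%N by rewrite /ps big_filter.
pose qs := rev ps.
have qsP : {in qs, forall p, prime p && (p%:R < z)}.
  by move=> p; rewrite mem_rev => /psP.
have qs_uniq : uniq qs by rewrite rev_uniq.
have qs_desc : desc_prime_seq qs.
  rewrite /desc_prime_seq rev_sorted ps_sorted /=.
  by apply/allP => p /qsP/andP[].
have PEq : P = (\prod_(q <- qs) q)%N.
  by rewrite PE; apply: perm_big; rewrite perm_sym perm_rev.
have divP : perm_eq (divisors P) (subset_prods qs).
  by rewrite PEq perm_divisors_prod.
have primesP : perm_eq (primes P) qs.
  apply: uniq_perm => //; first exact: primes_uniq.
  move=> p; apply/idP/idP => [|pqs].
    rewrite mem_primes => /and3P[pp P0 pP].
    have := proj2 (subset_prods_primes _ p qs_desc _) p; apply.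
      by rewrite -(perm_mem divP) -dvdn_divisors.
    by rewrite primes_prime ?mem_seq1.
  case/andP: (qsP p pqs) => pp _; rewrite mem_primes pp PEq (big_rem p)//=.
  rewrite dvdn_mulr// andbT muln_gt0 prime_gt0//= big_seq.
  by apply: prodn_cond_gt0 => q /mem_rem/qsP/andP[/prime_gt0].
rewrite (perm_big _ primesP).
have -> : \sum_(d <- divisors P)
    d%:R * (\sum_(m <- divisors P | (d %| m)%N) lambda m / m%:R) ^+ 2 =
  qform lambda qs.
  rewrite (perm_big _ divP) /qform; apply: eq_bigr => d _.
  by rewrite /divsum (perm_big _ divP).
have [t [tS lamE inv]] : exists t : nat -> bool,
   [/\ forall r, t r.+1 = ~~ t r, lambda =1 trunc_weight R t beta D 1 0
     & level_inv R t beta D z 1 0 qs].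
  have adm t m := admissible_all R t beta D 1 0 (desc_primes m).
  have c0 : cutoff R z 0 = z.
    by rewrite /cutoff expr0 powRr1//; lra.
  case: hlam => ->.
    exists odd; split => // [m|].
      rewrite /upper_beta_weight /trunc_weight adm; congr (if _ then _ else _).
      by apply: eq_all => k; rewrite add0n /beta_cond mul1r.
    by rewrite /level_inv /= c0 mul1r.
  exists (fun r => ~~ odd r); split => // [m|].
    rewrite /lower_beta_weight /trunc_weight adm; congr (if _ then _ else _).
    by apply: eq_all => k; rewrite add0n /beta_cond mul1r.
  (* Index 1 is free for the lower weights, so the bound needed is q z^((7/8)(beta + 1)) <= D; it
     follows from q < z and (7/8)(beta + 1) <= beta. *)
  rewrite /level_inv /= => q /qsP/andP[pq qz]; rewrite mul1r cutoffS c0.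
  rewrite -powRrM; apply: le_trans zD1.
  have <- : z * z `^ (beta + 1 - 1) = z `^ (beta + 1).
    by rewrite mulr_powRB1//; lra.
  apply: ler_pM; rewrite ?powR_ge0 ?(ltW qz)//.
  by rewrite ler_powR//; lra.
rewrite (qform_ext _ _ (fun m => trunc_err R t beta D 1 0 m + (mobius m)%:~R));
  last by move=> m _; rewrite /trunc_err subrK lamE.
apply: le_trans (qformD _ _ _ _) _.
rewrite qform_mobius//.
have := qform_trunc_err_le R t beta D hbeta tS z z1 (size qs) qs 1 0 qs_desc
  ltr01 inv (leqnn _).
rewrite expr0 mul1r => /le_trans/(_ (sum_err_bound_le R z z1 _ _ qs_uniq qsP)).
have := prod_mobius_factor_le R qs qs_uniq (proj2 (andP qs_desc)).
by rewrite -/K => h1 h2; lra.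
Qed.
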